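(* Let $k\ge 2$ and let $\alpha\neq 0^{k-1}$ be a $k$-germ with parent $\beta$ in $\mathcal T_k$, and let $i=i(\alpha)$. Then the signatures $A(\beta)=(A_{k-1}(\beta),\dots,A_1(\beta))$ and $A(\alpha)=(A_{k-1}(\alpha),\dots,A_1(\alpha))$ differ exactly at the $i$-th entry: $A_i(\beta)\neq A_i(\alpha)$, while $A_j(\beta)=A_j(\alpha)$ for all $j\in[1,k-1]$ with $j\neq i$.
   Context: A $k$-germ ($k\ge 2$) is a string $\alpha=a_{k-1}a_{k-2}\cdots a_1$ of nonnegative integers with $a_{k-1}\in\{0,1\}$ and $0\le a_{i-1}\le a_i+1$ for $1<i<k$. For $\alpha\neq 0^{k-1}$ let $i(\alpha)$ be the index of the rightmost nonzero entry of $\alpha$, and let the parent $\beta$ of $\alpha$ be the $k$-germ equal to $\alpha$ except that $b_{i(\alpha)}=a_{i(\alpha)}-1$; this makes the $k$-germs the nodes of a tree $\mathcal T_k$ rooted at $0^{k-1}$. The $n$-nest $F(\alpha)$ ($n=2k+1$) is defined recursively along $\mathcal T_k$: $F(0^{k-1})=0\,1\,2\cdots(k-1)\,k\,k\,(k-1)\cdots 2\,1$; for $\alpha\ne 0^{k-1}$ with parent $\beta$ and $i=i(\alpha)$, write $F(\beta)=W^i|M|Z^i$ where $W^i$, $Z^i$ are the leftmost and rightmost substrings of length $i$, let $c$ be the leftmost entry of $M$, and split $M=X|Y$ where $Y$ starts at the (leftmost) entry equal to $c+1$ in $M$; then $F(\alpha)=W^i|Y|X|Z^i$. Each $j\in[1,k]$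 appears exactly twice in $F(\alpha)$, at positions $p_j<q_j$. The signature of $\alpha$ is $A(\alpha)=(A_{k-1}(\alpha),\dots,A_1(\alpha))$ with $A_j(\alpha)=\lfloor (q_j-p_j)/2\rfloor$ (equivalently, the number of integers both of whose appearances lie strictly between the two appearances of $j$ in $F(\alpha)$). *)

(* Defs.v *)
From mathcomp Require Import all_boot.
From mathcomp Require Import zify.

Set Implicit Arguments.
Unset Strict Implicit.
Unset Printing Implicit Defensive.

(* A string a_{k-1} a_{k-2} ... a_1 is the sequence [:: a_{k-1}; ...; a_1], so
   that its entry of index j is the j-th one from the right, counted from 1. *)
Definition entry (s : seq nat) (j : nat) : nat := nth 0 s (size s - j).

Definition is_germ (k : nat) (alpha : seq nat) : Prop :=
  [/\ size alpha = k.-1,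
      entry alpha k.-1 \in [:: 0; 1]
    & forall i, 1 < i < k -> entry alpha i.-1 <= (entry alpha i).+1].

Definition root_germ (k : nat) : seq nat := nseq k.-1 0.

(* i(alpha); the value is irrelevant when all the entries vanish *)
Definition last_nz (alpha : seq nat) : nat :=
  (find (fun a => a != 0) (rev alpha)).+1.

Definition parent (alpha : seq nat) : seq nat :=
  let i := last_nz alpha in
  set_nth 0 alpha (size alpha - i) (entry alpha i).-1.

Definition nest0 (k : nat) : seq nat := iota 0 k.+1 ++ rev (iota 1 k).

(* From W|M|Z with W and Z of length i, and M = X|Y where Y starts at the
   leftmost entry of M equal to 1 + (first entry of M), to W|Y|X|Z.  Were there
   no such entry, Y would be empty and the result would be s itself. *)
Definition castle (i : nat) (s : seq nat) : seq nat :=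
  let W := take i s in
  let M := drop i (take (size s - i) s) in
  let Z := drop (size s - i) s in
  let c := head 0 M in
  let X := take (index c.+1 M) M in
  let Y := drop (index c.+1 M) M in
  W ++ Y ++ X ++ Z.

(* The sum of the entries drops by one from a germ to its parent, so it is the
   depth of the germ in the tree; see nest_root and nest_parent below for the
   recursion that nest satisfies. *)
Fixpoint nest_rec (k depth : nat) (alpha : seq nat) : seq nat :=
  if depth is d.+1 then castle (last_nz alpha) (nest_rec k d (parent alpha))
  else nest0 k.

Definition nest (k : nat) (alpha : seq nat) : seq nat :=
  nest_rec k (sumn alpha) alpha.

(* Positions are counted from 0. *)
Definition fst_pos (j : nat) (s : seq nat) : nat := index j s.

Definition snd_pos (j : nat) (s : seq nat) : nat :=
  (fst_pos j s).+1 + index j (drop (fst_pos j s).+1 s).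

Definition signature (k : nat) (alpha : seq nat) (j : nat) : nat :=
  (snd_pos j (nest k alpha) - fst_pos j (nest k alpha))./2.

Lemma has_nz k alpha :
  size alpha = k.-1 -> alpha <> root_germ k -> has (fun a => a != 0) alpha.
Proof.
move=> sz nr; apply/negPn/negP=> /hasPn h; apply: nr.
by rewrite /root_germ -sz; apply/all_pred1P/allP=> x /h /negPn.
Qed.

Lemma last_nzP k alpha : is_germ k alpha -> alpha <> root_germ k ->
  [/\ 1 <= last_nz alpha <= k.-1, entry alpha (last_nz alpha) != 0
    & forall j, 1 <= j < last_nz alpha -> entry alpha j = 0].
Proof.
move=> [sz _ _] /(has_nz sz); rewrite -has_rev => h.
have lt := h; rewrite has_find size_rev in lt.
have eE j : 0 < j <= size alpha -> entry alpha j = nth 0 (rev alpha) j.-1.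
  by case: j => // j jl; rewrite nth_rev.
split; first by rewrite /last_nz -sz.
- by rewrite eE //; exact: (nth_find 0 h).
- move=> j /andP[j0]; rewrite /last_nz ltnS => jl.
  rewrite eE ?j0 ?(leq_trans jl (ltnW lt)) //.
  have jf : j.-1 < find (fun a => a != 0) (rev alpha) by rewrite prednK.
  by apply/eqP/negPn; rewrite (before_find 0 jf).
Qed.

Lemma entry_parent k alpha j : is_germ k alpha -> alpha <> root_germ k ->
  1 <= j <= k.-1 ->
  entry (parent alpha) j =
    if j == last_nz alpha then (entry alpha j).-1 else entry alpha j.
Proof.
move=> gm nr hj; have [li _ _] := last_nzP gm nr; have [sz _ _] := gm.
have szp : size (parent alpha) = size alpha.
  by rewrite size_set_nth; apply/maxn_idPr; lia.
rewrite {1}/entry szp nth_set_nth /=.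
case: eqP => [e|ne]; case: eqP => [e'|ne'] //; first by rewrite e'.
- by exfalso; lia.
- by exfalso; apply: ne; rewrite e'.
Qed.

Lemma parent_germ k alpha : 2 <= k ->
  is_germ k alpha -> alpha <> root_germ k -> is_germ k (parent alpha).
Proof.
move=> k2 gm nr; have [li nz zs] := last_nzP gm nr; have [sz lc st] := gm.
have eP := entry_parent gm nr.
split.
- by rewrite size_set_nth sz; apply/maxn_idPr; lia.
- rewrite eP; last by lia.
  by move: lc; rewrite !inE; case: (k.-1 == _) => //; lia.
- move=> i hi; rewrite !eP; try by lia.
  have := st i hi; case: eqP => [e|_]; case: eqP => [e'|_]; try by lia.
  by move=> _; rewrite zs //; lia.
Qed.

Lemma sumn_parent k alpha : is_germ k alpha -> alpha <> root_germ k ->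
  sumn alpha = (sumn (parent alpha)).+1.
Proof.
move=> gm nr; have [li nz _] := last_nzP gm nr; have [sz _ _] := gm.
rewrite sumn_set_nth -/(entry alpha _).
have lt : size alpha - last_nz alpha < size alpha by lia.
have : entry alpha (last_nz alpha) <= sumn alpha.
  have -> : sumn alpha = sumn (take (size alpha - last_nz alpha) alpha)
                         + sumn (drop (size alpha - last_nz alpha) alpha).
    by rewrite -sumn_cat cat_take_drop.
  by rewrite (drop_nth 0 lt) /= /entry addnCA leq_addr.
by lia.
Qed.

Lemma nest_root k : nest k (root_germ k) = nest0 k.
Proof. by rewrite /nest sumn_nseq. Qed.

Lemma nest_parent k alpha : is_germ k alpha -> alpha <> root_germ k ->
  nest k alpha = castle (last_nz alpha) (nest k (parent alpha)).
Proof. by move=> gm nr; rewrite /nest (sumn_parent gm nr). Qed.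

Lemma perm_castle i s : i + i <= size s -> perm_eq (castle i s) s.
Proof.
move=> h; rewrite /castle; set M := drop i _.
have e : s = take i s ++ M ++ drop (size s - i) s.
  rewrite catA -{1}(cat_take_drop (size s - i) s); congr cat.
  by rewrite -{1}(cat_take_drop i (take (size s - i) s)) take_takel //; lia.
have eM : M = take (index (head 0 M).+1 M) M ++ drop (index (head 0 M).+1 M) M.
  by rewrite cat_take_drop.
rewrite [X in perm_eq _ X]e perm_cat2l catA perm_cat2r.
by rewrite [X in perm_eq _ X]eM perm_catC.
Qed.

Lemma perm_nest k alpha : 2 <= k -> is_germ k alpha ->
  perm_eq (nest k alpha) (nest0 k).
Proof.
move=> k2; have [n] := ubnP (sumn alpha).
elim: n alpha => // n IHn alpha lt gm.
have [->|/eqP nr] := eqVneq alpha (root_germ k); first by rewrite nest_root.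
have IH : perm_eq (nest k (parent alpha)) (nest0 k).
  by apply: IHn; [move: lt; rewrite (sumn_parent gm nr) | exact: parent_germ].
rewrite nest_parent //; apply: (perm_trans _ IH); apply: perm_castle.
rewrite (perm_size IH) /nest0 size_cat size_rev !size_iota.
by have [li _ _] := last_nzP gm nr; lia.
Qed.

Lemma count_nest k alpha j : 2 <= k -> is_germ k alpha -> 1 <= j <= k ->
  count_mem j (nest k alpha) = 2.
Proof.
move=> k2 gm hj; rewrite (permP (perm_nest k2 gm)) /nest0 count_cat count_rev.
by rewrite !count_uniq_mem ?iota_uniq // !mem_iota; lia.
Qed.

Lemma pos_nest k alpha j : 2 <= k -> is_germ k alpha -> 1 <= j <= k ->
  let p := fst_pos j (nest k alpha) in
  let q := snd_pos j (nest k alpha) in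
  [/\ p < q < size (nest k alpha),
      nth 0 (nest k alpha) p = j & nth 0 (nest k alpha) q = j].
Proof.
move=> k2 gm hj; have := count_nest k2 gm hj.
rewrite /snd_pos /fst_pos; set s := nest k alpha => c2 /=.
set p := index j s.
have js : j \in s by rewrite -has_pred1 has_count c2.
have lp : p < size s by rewrite index_mem.
have ed : s = take p s ++ j :: drop p.+1 s.
  by rewrite -{1}(cat_take_drop p s) (drop_nth 0 lp) nth_index.
have jd : j \in drop p.+1 s.
  rewrite -has_pred1 has_count; move: c2; rewrite {1}ed count_cat /= eqxx.
  have /count_memPn-> : j \notin take p s by rewrite in_take // ltnn.
  by rewrite add0n add1n => -[->].
split; last by rewrite -nth_drop nth_index.
- by move: jd; rewrite -index_mem size_drop ltn_subRL leq_addr.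
- by rewrite nth_index.
Qed.

(* Main.v *)
Require Import Defs.
From mathcomp Require Import all_boot.
From mathcomp Require Import zify.

Set Implicit Arguments.
Unset Strict Implicit.
Unset Printing Implicit Defensive.

(** Call a nonempty string a block if each of its letters occurs exactly twice
    in it.  If all the entries of [alpha] of index less than [i] vanish, then
    [F(alpha) = 0 1 ... (i-1) | B_r ... B_1 i B_m ... B_(r+1) | i ... 2 1],
    where [r = a_i], [m = a_(i+1) + 1] (with [a_k = 0]), and [B_s] is a block
    with first letter [i + s].  Passing from [a_i = r] to [a_i = r + 1] moves
    [B_(r+1)] in front of [B_r]; passing from [i + 1] to [i], the letter [i + 1]
    and its mate in the tail enclose the blocks between them to form a new one.
    Hence a castling moves a whole block out of the span of [i], so it changes
    [A_i], and no other pair of mates is separated. *)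

(** * Distances between the two appearances of a letter *)

Definition gap (j : nat) (s : seq nat) : nat := snd_pos j s - fst_pos j s.

Lemma gap_pair (j : nat) (u v w : seq nat) : j \notin u -> j \notin v ->
  gap j (u ++ j :: v ++ j :: w) = (size v).+1.
Proof.
move=> ju jv; rewrite /gap /snd_pos /fst_pos.
have -> : index j (u ++ j :: v ++ j :: w) = size u.
  by rewrite index_cat (negbTE ju) /= eqxx addn0.
rewrite -cat_rcons -(size_rcons u j) drop_size_cat // index_cat (negbTE jv) /=.
by rewrite eqxx size_rcons; lia.
Qed.

Lemma count_mem_split (j : nat) s : 0 < count_mem j s ->
  exists u v, s = u ++ j :: v /\ j \notin u.
Proof.
rewrite -has_count has_pred1 => js.
exists (take (index j s) s), (drop (index j s).+1 s); split.
  by rewrite -{1}(cat_take_drop (index j s) s) (drop_nth 0) ?index_mem // nth_index.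
by rewrite in_take // ltnn.
Qed.

(** The first two appearances of [j] in [u ++ s ++ w] are those in [s], so the surroundings shift
    both positions equally. *)
Lemma gap_cat (j : nat) (u s w : seq nat) : j \notin u -> count_mem j s = 2 ->
  gap j (u ++ s ++ w) = gap j s.
Proof.
move=> ju c2; have [|u1 [s1 [es ju1]]] := @count_mem_split j s; first by rewrite c2.
move: c2; rewrite es count_cat /= eqxx (count_memPn ju1) add0n add1n => -[c1].
have [|v [w1 [es1 jv]]] := @count_mem_split j s1; first by rewrite c1.
rewrite es1 -catA /= -catA /= catA !gap_pair //.
by rewrite mem_cat negb_or ju.
Qed.

Lemma castle_cat i (W X Y Z : seq nat) c :
  size W = i -> size Z = i -> X != [::] -> head 0 X = c -> c.+1 \notin X ->
  Y != [::] -> head 0 Y = c.+1 ->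
  castle i (W ++ X ++ Y ++ Z) = W ++ Y ++ X ++ Z.
Proof.
move=> sW sZ X0 hX cX Y0 hY; rewrite /castle.
have -> : size (W ++ X ++ Y ++ Z) - i = size (W ++ X ++ Y).
  by rewrite !size_cat sZ; lia.
have -> : take i (W ++ X ++ Y ++ Z) = W by rewrite take_size_cat.
have -> : W ++ X ++ Y ++ Z = (W ++ X ++ Y) ++ Z by rewrite -!catA.
rewrite take_size_cat // !(drop_size_cat _ sW) (drop_size_cat _ erefl).
have -> : head 0 (X ++ Y) = c by case: X X0 hX {cX}.
have -> : index c.+1 (X ++ Y) = size X.
  rewrite index_cat (negbTE cX).
  by case: Y Y0 hY => //= y Y _ ->; rewrite eqxx addn0.
by rewrite take_size_cat // drop_size_cat.
Qed.

(** * Blocks and their arrangement around a letter *)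

Definition block (B : seq nat) : bool :=
  (B != [::]) && all (fun x => count_mem x B == 2) B.

Definition blocks (h m : nat) (Bs : seq (seq nat)) : bool :=
  all block Bs && (map (head 0) Bs == rev (iota h m)).

(** In the notation above, [P] is [B_r ... B_1], [Q] is [B_m ... B_(r+1)], and [t = m - r] counts
    the blocks still behind the middle [i]. *)
Definition nest_shape (i r t : nat) (s : seq nat) : Prop :=
  exists P Q, [/\ s = iota 0 i ++ (flatten P ++ i :: flatten Q) ++ rev (iota 1 i),
    blocks i.+1 r P & blocks (i.+1 + r) t Q].

Lemma rev_iotaS h m : rev (iota h m.+1) = rcons (rev (iota h.+1 m)) h.
Proof. by rewrite /= rev_cons. Qed.

Lemma rev_iota_last h m : rev (iota h m.+1) = h + m :: rev (iota h m).
Proof. by rewrite -addn1 iotaD rev_cat. Qed.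

Lemma blocks_rcons h m Bs B :
  blocks h m.+1 (rcons Bs B) = [&& blocks h.+1 m Bs, block B & head 0 B == h].
Proof.
rewrite /blocks rev_iotaS map_rcons all_rcons eqseq_rcons.
by case: (block B); rewrite ?andbF //= andbA.
Qed.

Lemma blocksSP h m Bs : blocks h m.+1 Bs ->
  exists Bs' B, [/\ Bs = rcons Bs' B, blocks h.+1 m Bs', block B & head 0 B = h].
Proof.
case/lastP: Bs => [|Bs' B]; first by rewrite /blocks rev_iotaS /=; case: rev.
by rewrite blocks_rcons => /and3P [bs b /eqP hB]; exists Bs', B.
Qed.

Lemma block_count B (x : nat) : block B -> count_mem x B = if x \in B then 2 else 0.
Proof.
move=> /andP [_ /allP h].
have [/h /eqP|/count_memPn] := boolP (x \in B); by [].
Qed.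

Lemma block_head B : block B -> count_mem (head 0 B) B = 2.
Proof.
move=> bB; rewrite block_count //; case: B bB => // x B _.
by rewrite /= inE eqxx.
Qed.

Lemma count_flatten_blocks Bs (x : nat) : all block Bs -> count_mem x (flatten Bs) != 1.
Proof.
elim: Bs => //= B Bs IH /andP [bB /IH].
by rewrite count_cat (block_count x bB); case: (x \in B).
Qed.

(** The block that moves is the last one of the right-hand group: its head [i.+1 + r] is one more
    than the head of [X], which is [i] if [r = 0] and the head of the first block of [P]
    otherwise. *)
Lemma nest_shape_step i r t s : (forall x, count_mem x s <= 2) ->
  nest_shape i r t.+1 s ->
  exists P Q B, let X := flatten P ++ i :: flatten Q in
    [/\ [/\ blocks i.+1 r P, blocks (i.+1 + r).+1 t Q, block B
          & head 0 B = i.+1 + r],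
        s = iota 0 i ++ X ++ B ++ rev (iota 1 i)
      & castle i s = iota 0 i ++ B ++ X ++ rev (iota 1 i)].
Proof.
move=> c2 [P [QB [es bP /blocksSP [Q [B [eQ bQ bB hB]]]]]].
have {QB eQ}es : s = iota 0 i ++ (flatten P ++ i :: flatten Q) ++ B ++ rev (iota 1 i).
  by rewrite es eQ flatten_rcons -!catA /= -!catA.
exists P, Q, B; split=> //; rewrite es.
set X := _ ++ _ :: _ in es *.
have hX : head 0 X = i + r.
  rewrite /X; case: P bP {X es} => [|C P] /andP [/= bl].
    by case: r {bQ hB} => [|r]; rewrite ?rev_iota_last ?addn0.
  case/andP: bl; case: C => // x C _ _; case: r {bQ hB} => // r.
  by rewrite rev_iota_last eqseq_cons => /andP [/eqP /= -> _]; rewrite addSnnS.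
apply: (castle_cat (c := i + r)); rewrite ?size_rev ?size_iota //.
- by rewrite /X; case: (flatten P).
(* [B] holds two copies of its head and [s] has at most two, so none is left for [X]. *)
- apply/count_memPn; have := block_head bB; have := c2 (i.+1 + r).
  by rewrite es !count_cat hB addSn; lia.
- by case/andP: bB.
Qed.

Lemma nest_shape_castle i r t s : (forall x, count_mem x s <= 2) ->
  nest_shape i r t.+1 s -> nest_shape i r.+1 t (castle i s).
Proof.
move=> c2 /(nest_shape_step c2) [P [Q [B [[/andP [bP hP] bQ bB hB] _ ->]]]].
exists (B :: P), Q; split; rewrite ?addnS //=; first by rewrite -!catA.
by rewrite /blocks /= bB bP rev_iota_last hB eqseq_cons eqxx.
Qed.

(** The [r] blocks of [P] survive, and those of [Q] merge into a single block with head [i.+1]; this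
    is why [m = a_(i+1) + 1]. *)
Lemma nest_shape_down i r t s : (forall x, count_mem x s <= 2) ->
  nest_shape i.+1 r t s -> nest_shape i 0 r.+1 s.
Proof.
move=> c2 [P [Q [es bP /andP [bQ _]]]].
exists [::], (rcons P (i.+1 :: rcons (flatten Q) i.+1)).
have {}es : s = iota 0 i ++ i :: flatten P ++
    (i.+1 :: rcons (flatten Q) i.+1) ++ rev (iota 1 i).
  rewrite es rev_iota_last -(addn1 i) iotaD /= add0n add1n addn1.
  by rewrite -!catA /= cat_rcons.
split=> //; first by rewrite flatten_rcons es /= -!catA.
rewrite addn0 blocks_rcons bP eqxx andbT; apply/allP => x.
(* A letter of the new block other than [i.+1] comes from [Q], where it cannot occur just once; [c2]
   then leaves exactly two occurrences. *)
rewrite -has_pred1 has_count -cats1 -cat1s !count_cat /= addn0.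
have := c2 x; rewrite es -cats1 -(cat1s i.+1) -(cat1s i) !count_cat /= !addn0.
by have := count_flatten_blocks x bQ; case: (i.+1 == x) => /=; lia.
Qed.

(** * Shapes of the nests of germs *)

Lemma count_nest_le2 k alpha x : 2 <= k -> is_germ k alpha ->
  count_mem x (nest k alpha) <= 2.
Proof.
move=> k2 gm; rewrite (permP (perm_nest k2 gm)) /nest0 count_cat count_rev.
by rewrite !count_uniq_mem ?iota_uniq //; do 2 case: (x \in _).
Qed.

(* The number [m] of blocks; [entry alpha k] would be [a_(k-1)], not [0]. *)
Definition nb_blocks (k : nat) (alpha : seq nat) (i : nat) : nat :=
  if i == k.-1 then 1 else (entry alpha i.+1).+1.

(** The germ inequalities keep the difference [nb_blocks k alpha i - entry alpha i] from being
    truncated. *)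
Lemma entry_le_nb_blocks k alpha i : is_germ k alpha -> 1 <= i <= k.-1 ->
  entry alpha i <= nb_blocks k alpha i.
Proof.
move=> [_ lc st] hi; rewrite /nb_blocks; case: eqP => [->|ne].
  by move: lc; rewrite !inE; lia.
by apply: (st i.+1); lia.
Qed.

Lemma last_nz_eq k alpha i : is_germ k alpha -> alpha <> root_germ k ->
  1 <= i -> entry alpha i != 0 -> (forall j, 1 <= j < i -> entry alpha j = 0) ->
  last_nz alpha = i.
Proof.
move=> gm nr i1 nz zs; have [/andP [l1 _] lnz lzs] := last_nzP gm nr.
case: (ltngtP (last_nz alpha) i) => // h.
  by move: lnz; rewrite zs ?l1.
by move: nz; rewrite lzs ?i1.
Qed.

Lemma entry_root k i : entry (root_germ k) i = 0.
Proof. by rewrite /entry nth_nseq if_same. Qed.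

Lemma nb_blocks_parent k alpha : is_germ k alpha -> alpha <> root_germ k ->
  nb_blocks k (parent alpha) (last_nz alpha) = nb_blocks k alpha (last_nz alpha).
Proof.
move=> gm nr; have [li _ _] := last_nzP gm nr.
rewrite /nb_blocks; case: eqP => // ne; rewrite (entry_parent gm nr); last by lia.
by rewrite ifN //; lia.
Qed.

(** Outer induction on the depth of [alpha], inner induction on [k - i]. If [a_i = 0], the shape at
    [i] comes down from [i.+1]; otherwise [i] is [last_nz alpha] and the shape comes from the parent
    by a castling. *)
Lemma nest_shapeP k alpha i : 2 <= k -> is_germ k alpha -> 1 <= i <= k.-1 ->
  (forall j, 1 <= j < i -> entry alpha j = 0) ->
  nest_shape i (entry alpha i) (nb_blocks k alpha i - entry alpha i) (nest k alpha).
Proof.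
move=> k2; have [n] := ubnP (sumn alpha); elim: n alpha i => // n IHn alpha i lt gm.
have c2 x := @count_nest_le2 k alpha x k2 gm.
have [d] := ubnP (k - i); elim: d i => // d IHd i ltd hi zs.
have [e0|nz] := eqVneq (entry alpha i) 0.
  rewrite e0 subn0 /nb_blocks; case: eqP => [ei|ne].
    have -> : alpha = root_germ k.
      apply/eqP/negPn/negP => /eqP nr; have [li lnz _] := last_nzP gm nr.
      move: lnz; have [->|h] := eqVneq (last_nz alpha) i; first by rewrite e0.
      by rewrite zs //; lia.
    (* The descent starts at the letter [k], one beyond the range of [i]: there [nest0 k] has no
       block on either side. *)
    rewrite nest_root; apply: (@nest_shape_down _ _ 0).
      move=> x; rewrite /nest0 count_cat count_rev !count_uniq_mem ?iota_uniq //.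
      by do 2 case: (x \in _).
    have -> : i.+1 = k by lia.
    exists [::], [::]; split=> //; rewrite /nest0 -(addn1 k) iotaD -catA //.
  apply: nest_shape_down c2 (IHd i.+1 _ _ _); try lia.
  move=> j hj; have [->//|h] := eqVneq j i; apply: zs; lia.
have nr : alpha <> root_germ k by move=> ea; rewrite ea entry_root in nz.
have i1 : 1 <= i by case/andP: hi.
have li := last_nz_eq gm nr i1 nz zs.
have := entry_le_nb_blocks gm hi.
have eP := entry_parent gm nr; have := nb_blocks_parent gm nr.
rewrite li => nbP le; rewrite nest_parent // li.
have gp := parent_germ k2 gm nr.
have := IHn (parent alpha) i; rewrite nbP eP // li eqxx => IH.
rewrite -{1}(prednK (n := entry alpha i)) ?lt0n //; apply: nest_shape_castle.
  by move=> x; exact: count_nest_le2.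
have ltp : (sumn (parent alpha)).+1 < n.+1 by rewrite -(sumn_parent gm nr).
have -> : (nb_blocks k alpha i - entry alpha i).+1
  = nb_blocks k alpha i - (entry alpha i).-1 by move: nz; lia.
apply: IH => // j hj; rewrite eP; last by lia.
by rewrite ifN ?li; [exact: zs | lia].
Qed.

Theorem theorem6 (k : nat) (hk : 2 <= k)
    (alpha : seq nat) (halpha : is_germ k alpha) (hroot : alpha <> root_germ k)
    (beta : seq nat) (hbeta : beta = parent alpha)
    (i : nat) (hi : i = last_nz alpha) :
  signature k beta i <> signature k alpha i /\
  (forall j : nat, 1 <= j <= k.-1 -> j <> i ->
     signature k beta j = signature k alpha j).
Proof.
have [li nz zs] := last_nzP halpha hroot.
have eP := entry_parent halpha hroot.
have gb := parent_germ hk halpha hroot.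
have c2 x := @count_nest_le2 k (parent alpha) x hk gb.
have zsb j : 1 <= j < last_nz alpha -> entry (parent alpha) j = 0.
  by move=> hj; rewrite eP ?ifN; [exact: zs | lia | lia].
(* Since [a_i <= m], the parent's entry [a_i - 1] is less than [m], so a block is left to be
   moved. *)
have [t] : exists t, nest_shape (last_nz alpha) (entry alpha (last_nz alpha)).-1
    t.+1 (nest k (parent alpha)).
  have := nest_shapeP hk gb li zsb; rewrite nb_blocks_parent // eP // eqxx.
  have := entry_le_nb_blocks halpha li.
  set m := nb_blocks _ _ _; set a := entry _ _ in nz * => le sh.
  exists (m - a); suff <- : m - a.-1 = (m - a).+1 by [].
  by move: nz; lia.
move=> /(nest_shape_step c2) [P [Q [B [[_ _ bB hB]]]]].
rewrite -hi in li; rewrite -nest_parent // -hi; set X := _ ++ _ :: _ => es ec.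
have sE a j : signature k a j = (gap j (nest k a))./2 by [].
have cP j : 1 <= j <= k.-1 -> count_mem j (nest k (parent alpha)) = 2.
  by move=> hj; rewrite count_nest //; lia.
have cW (j : nat) : count_mem j (iota 0 i) = (j < i).
  by rewrite count_uniq_mem ?iota_uniq // mem_iota.
have cZ j : 1 <= j -> count_mem j (rev (iota 1 i)) = (j <= i).
  by move=> hj; rewrite count_rev count_uniq_mem ?iota_uniq // mem_iota hj.
split.
(* A block has at least two letters, so losing [B] shortens the span of [i] by at least 2, which
   survives the halving. *)
- have B2 : 1 < size B by rewrite -(block_head bB) count_size.
  have := cP i li; rewrite es !count_cat cW cZ; last by case/andP: li.
  rewrite ltnn leqnn /= eqxx => ci.
  have [i' ei] : exists i', i = i'.+1; first by exists i.-1; lia.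
  have Z : rev (iota 1 i) = i :: rev (iota 1 i') by rewrite ei rev_iota_last.
  have notin (s : seq nat) : count_mem i s = 0 -> i \notin s by move/count_memPn.
  rewrite hbeta !sE ec es Z.
  have -> : iota 0 i ++ X ++ B ++ i :: rev (iota 1 i') =
    (iota 0 i ++ flatten P) ++ i :: (flatten Q ++ B) ++ i :: rev (iota 1 i').
    by rewrite -!catA.
  have -> : iota 0 i ++ B ++ X ++ i :: rev (iota 1 i') =
    (iota 0 i ++ B ++ flatten P) ++ i :: flatten Q ++ i :: rev (iota 1 i').
    by rewrite -!catA.
  rewrite !gap_pair ?size_cat.
    apply/eqP; rewrite neq_ltn orbC.
    have /half_leq : (size (flatten Q)).+3 <= (size (flatten Q) + size B).+1.
      by rewrite -addn2 -addSn leq_add2l.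
    by move=> /= ->.
  1-4: by apply: notin; rewrite ?count_cat ?cW ?ltnn /=; lia.
- clearbody X => j hj ji; have := cP j hj.
  rewrite es !count_cat cW cZ; last by case/andP: hj.
  move=> cj.
  have notin (s : seq nat) : count_mem j s = 0 -> j \notin s by move/count_memPn.
  (* For [j < i] one copy lies in the prefix and one in the suffix; swapping [X] and [B] between
     them keeps the distance. *)
  rewrite hbeta !sE ec es; congr _./2; case: (ltnP j i) => jli.
    have W : iota 0 i = iota 0 j ++ j :: iota j.+1 (i - j.+1).
      by rewrite -[j :: _]/(iota j (i - j.+1).+1) -iotaD; congr iota; lia.
    have [j' ej] : exists j', j = j'.+1; first by exists j.-1; lia.
    have Z : rev (iota 1 i) = rev (iota j.+1 (i - j)) ++ j :: rev (iota 1 j').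
      rewrite -{1}(subnKC (ltnW jli)) iotaD rev_cat add1n; congr (_ ++ _).
      by rewrite ej rev_iota_last.
    have jX : j \notin X by apply: notin; move: cj => /=; lia.
    have jB : j \notin B by apply: notin; move: cj => /=; lia.
    rewrite W Z.
    have assoc U V : (iota 0 j ++ j :: iota j.+1 (i - j.+1)) ++ U ++ V ++
        rev (iota j.+1 (i - j)) ++ j :: rev (iota 1 j') =
      iota 0 j ++ j :: (iota j.+1 (i - j.+1) ++ U ++ V ++ rev (iota j.+1 (i - j)))
        ++ j :: rev (iota 1 j').
      by rewrite -!catA.
    rewrite !assoc !gap_pair ?size_cat; first by lia.
    1-4: by rewrite ?mem_cat ?mem_rev ?mem_iota ?(negbTE jX) ?(negbTE jB); lia.
  have e0 : (j < i) = false /\ (j <= i) = false by lia.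
  rewrite e0.1 e0.2 /= in cj.
  have jW : j \notin iota 0 i by apply: notin; rewrite cW e0.1.
  (* For [j > i] the prefix and the suffix are free of [j], and [B] holds both copies or neither; so
     the mates move together, inside [B] or inside [X]. *)
  have := block_count j bB; case: ifP => _ cB.
    have jX : j \notin X by apply: notin; move: cj cB => /=; lia.
    by rewrite catA !gap_cat // mem_cat negb_or jW.
  have cX : count_mem j X = 2 by move: cj cB => /=; lia.
  have jB := notin _ cB.
  by rewrite [in RHS]catA !gap_cat // mem_cat negb_or jW.
Qed.
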